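(* For every integer $n\geqslant1$, $$|\mathrm{IEnd}(S_n)|=3+3n^2-4n+\sum_{k=2}^{n-1}\left(\binom{n}{k}+\binom{n-1}{k}\right)\binom{n-1}{k}k!.$$
   Context: For $n\geqslant1$, the star graph $S_n$ is the simple graph with vertex set $\{0,1,\ldots,n-1\}$ and edge set $E=\{\{0,i\}\mid 1\leqslant i\leqslant n-1\}$. For a finite simple graph $G=(V,E)$, $\mathrm{IEnd}(G)$ is the set of all injective partial endomorphisms of $G$, i.e. injective partial maps $\alpha:V\to V$ (including the empty one; written on the right) such that for all $u,v\in\mathrm{Dom}(\alpha)$, $\{u,v\}\in E$ implies $\{u\alpha,v\alpha\}\in E$. Empty sums are $0$. *)

(* Defs.v *)
From mathcomp Require Import all_boot.

Set Implicit Arguments.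
Unset Strict Implicit.
Unset Printing Implicit Defensive.

Record sgraph := SGraph {
  vertex : finType;
  edges : {set {set vertex}};
  edges_card2 : forall e : {set vertex}, e \in edges -> #|e| = 2
}.

(* A partial map V -> V is encoded as f : {ffun V -> option V}, with f u = None
   when u is outside the domain; the empty map is the constant None. *)
Definition pmap_dom (V : finType) (f : {ffun V -> option V}) : {set V} :=
  [set u | f u != None].

Definition pmap_inj (V : finType) (f : {ffun V -> option V}) : bool :=
  [forall u in pmap_dom f, forall v in pmap_dom f, (f u == f v) ==> (u == v)].

(* The image f u is the u' with f u = Some u', so the quantification over
   u' and v' ranges exactly over u, v in the domain. *)
Definition pmap_endo (G : sgraph) (f : {ffun vertex G -> option (vertex G)}) :
    bool :=
  [forall u, forall v, forall u', forall v',
    [&& f u == Some u', f v == Some v' & [set u; v] \in edges G]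
      ==> ([set u'; v'] \in edges G)].

Definition IEnd (G : sgraph) : {set {ffun vertex G -> option (vertex G)}} :=
  [set f | pmap_inj f && pmap_endo f].

Definition star_edges (n : nat) : {set {set 'I_n}} :=
  [set [set z; i] | z in [set z : 'I_n | z == 0 :> nat],
                    i in [set i : 'I_n | 1 <= i]].

Lemma star_edges_card2 (n : nat) (e : {set 'I_n}) :
  e \in star_edges n -> #|e| = 2.
Proof.
case/imset2P=> z i; rewrite !inE => /eqP z0 i_gt0 ->.
rewrite cards2; case: eqVneq => // zi.
by rewrite -zi z0 in i_gt0.
Qed.

Definition star (n : nat) : sgraph := SGraph (@star_edges_card2 n).

(* Main.v *)
(* Split the maps according to the image of the centre 0.  If 0 is outside the
   domain, the domain spans no edge and any partial injection from the n-1
   leaves to all n vertices is allowed.  If 0 is fixed, the rest is any partial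
   injection between the leaves.  If 0 goes to a leaf j, every leaf of the
   domain must go to 0, so there is at most one of them: (n-1)n maps. *)
Require Import Defs.
From mathcomp Require Import all_boot all_order all_algebra.
From mathcomp Require Import zify.
Import GRing.Theory.
Local Open Scope ring_scope.

Set Implicit Arguments.
Unset Strict Implicit.
Unset Printing Implicit Defensive.

(** * Counting partial injections between two subsets of a finite type *)

Section PartialInjections.
Local Open Scope nat_scope.
Variable V : finType.
Implicit Types (f : {ffun V -> option V}) (A B D : {set V}).

Lemma pmap_injP f :
  reflect (forall u v w, f u = Some w -> f v = Some w -> u = v) (pmap_inj f).
Proof.
apply: (iffP 'forall_implyP) => [f_inj u v w fu fv | f_inj u].
  have /(_ _)/forall_inP/(_ v) := f_inj u; rewrite !inE fu fv eqxx.
  by move=> /(_ isT isT)/eqP.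
rewrite inE; case fu: (f u) => [w|] // _.
apply/forall_inP=> v _; apply/implyP=> /eqP/esym fv.
by apply/eqP; apply: f_inj fu fv.
Qed.

(** These stay partial maps on the whole of [V], so that they compare directly with members of
    [IEnd]. *)
Definition pinj A B : {set {ffun V -> option V}} :=
  [set f | [&& pmap_inj f, pmap_dom f \subset A
             & [forall u, forall w, (f u == Some w) ==> (w \in B)]]].

Lemma pinjP A B f :
  reflect [/\ pmap_inj f, forall u, u \notin A -> f u = None
             & forall u w, f u = Some w -> w \in B] (f \in pinj A B).
Proof.
rewrite inE; apply: (iffP and3P) => -[f_inj fA fB]; split=> //.
- move=> u; apply: contraNeq => fu.
  by apply: (subsetP fA); rewrite inE.
- by move=> u w /eqP fu; have /forallP/(_ w)/implyP := forallP fB u; apply.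
- by apply/subsetP=> u; rewrite inE; apply: contraNT => /fA ->.
- by apply/forallP=> u; apply/forallP=> w; apply/implyP=> /eqP /fB.
Qed.

(** Once the domain is fixed, restricting to [D] gives a total injection of [D] into [B]. Extension
    by [None] is the inverse, and the falling factorial counts such injections. *)
Lemma card_pinj_dom A B D :
  D \subset A -> #|[set f in pinj A B | pmap_dom f == D]| = #|B| ^_ #|D|.
Proof.
move=> DA.
pose ext (g : {ffun {x | x \in D} -> V}) : {ffun V -> option V} :=
  [ffun x => omap g (insub x)].
have extE g (x : {x | x \in D}) : ext g (val x) = Some (g x).
  by rewrite ffunE valK.
have ext_inj : injective ext.
  move=> g h gh; apply/ffunP=> x; apply: Some_inj.
  by rewrite -!extE gh.
have extS g u w : ext g u = Some w -> exists2 x, u = val x & w = g x.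
  by rewrite ffunE; case: insubP => //= x _ <- [<-]; exists x.
have -> : [set f in pinj A B | pmap_dom f == D] =
    ext @: [set g : {ffun {x | x \in D} -> V} in ffun_on (mem B)
               | injectiveb g].
  apply/setP=> f; rewrite inE; apply/andP/imsetP.
    case=> /pinjP[/pmap_injP f_inj _ fB] /eqP fD.
    (* The default [val x] is never taken: [f] is defined on all of [D]. *)
    pose g := [ffun x : {x | x \in D} => odflt (val x) (f (val x))].
    have gE x : f (val x) = Some (g x).
      rewrite ffunE; case fx: (f (val x)) => [w|] //.
      by have := valP x; move/setP/(_ (val x)): fD; rewrite inE fx /= => <-.
    exists g.
      rewrite inE; apply/andP; split.
        by apply/ffun_onP=> x; apply: fB (gE x).
      apply/injectiveP=> x y xy; apply: val_inj.
      by apply: f_inj (gE x) _; rewrite xy gE.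
    apply/ffunP=> u; rewrite ffunE; case: insubP => [x _ <- | uD] /=.
      exact: gE.
    by apply/eqP; move: uD; rewrite -fD inE negbK.
  case=> g; rewrite inE => /andP[/ffun_onP gB /injectiveP g_inj] ->.
  split; last first.
    apply/eqP/setP=> u; rewrite inE ffunE.
    by case: insubP => [x -> | /negPf ->].
  apply/pinjP; split.
  - apply/pmap_injP=> u v w /extS[x -> ->] /extS[y -> /g_inj ->] //.
  - move=> u uA; rewrite ffunE insubN //.
    by apply: contra uA; apply: subsetP.
  - by move=> u w /extS[x _ ->]; apply: gB.
rewrite card_imset // card_inj_ffuns_on card_sig; congr (_ ^_ _).
Qed.

Lemma card_pinj A B :
  #|pinj A B| = \sum_(k < #|A|.+1) 'C(#|A|, k) * #|B| ^_ k.
Proof.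
rewrite -sum1_card (partition_big (@pmap_dom V) (fun D => D \subset A)) /=;
  last first.
  by move=> f; rewrite inE => /and3P[].
(* Domains are grouped by size. [inord] does not truncate, since [D \subset A] bounds [#|D|] by
   [#|A|]. *)
rewrite (partition_big (fun D => inord #|D| : 'I_#|A|.+1) xpredT) //=.
apply: eq_bigr => k _.
rewrite -[X in X * _]cards_draws -[X in X * _]sum1_card big_distrl /=.
apply: eq_big => [D | D /andP[DA /eqP <-]].
  rewrite inE; case DA: (D \subset A) => //=.
  by rewrite -val_eqE /= inordK // ltnS subset_leq_card.
rewrite mul1n inordK ?ltnS ?subset_leq_card //.
rewrite -(card_pinj_dom B DA) -sum1_card.
by apply: eq_bigl => f; rewrite [in RHS]inE.
Qed.

End PartialInjections.

(** * Injective partial endomorphisms of the star on [m.+1] vertices *)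

Section Star.
Local Open Scope nat_scope.
Variable m : nat.
Notation V := 'I_m.+1.
Implicit Types f : {ffun V -> option V}.

(** An edge has exactly one end at the centre; the exclusive or also rejects the degenerate case
    [u = v]. *)
Lemma mem_star_edges (u v : V) :
  ([set u; v] \in star_edges m.+1) = (u == ord0) (+) (v == ord0).
Proof.
apply/imset2P/idP => [[z i] | ].
  rewrite !inE -[_ == 0 :> nat]/(z == ord0) => /eqP -> i_gt0 uv.
  have i0 : (i == ord0) = false by apply/eqP=> i0; rewrite i0 in i_gt0.
  (* Membership of [ord0] puts one of [u], [v] at the centre; membership of [i] keeps them from both
     being there. *)
  have := congr1 (fun A : {set V} => ord0 \in A) uv.
  have := congr1 (fun A : {set V} => i \in A) uv.
  rewrite /= !inE !eqxx orbT /= ![ord0 == _]eq_sym.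
  case: (eqVneq u ord0) => [->|] /=; case: (eqVneq v ord0) => [->|] //=.
  by rewrite i0.
case: (eqVneq u ord0) => [->|u0] /=; case: (eqVneq v ord0) => [->|v0] //= _.
  by exists ord0 v; rewrite ?inE ?lt0n.
by exists ord0 u; rewrite ?inE ?lt0n // setUC.
Qed.

(** Every edge contains the centre, so up to symmetry only the pairs made of [ord0] and a leaf need
    checking. *)
Lemma pmap_endo_starP f :
  reflect (forall c u w, u != ord0 -> f ord0 = Some c -> f u = Some w ->
             (c == ord0) (+) (w == ord0))
          (@pmap_endo (star m.+1) f).
Proof.
apply: (iffP forallP) => [f_endo c u w u0 fc fu | f_endo u].
  have /forallP/(_ u)/forallP/(_ c)/forallP/(_ w)/implyP := f_endo ord0.
  by rewrite fc fu !mem_star_edges !eqxx (negPf u0); apply.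
apply/forallP=> v; apply/forallP=> c; apply/forallP=> w; apply/implyP.
case/and3P=> /eqP fu /eqP fv; rewrite !mem_star_edges.
move: fu fv; case: (eqVneq u ord0) => [->|u0] fu;
  case: (eqVneq v ord0) => [->|v0] fv //= _.
  exact: f_endo v0 fu fv.
by rewrite addbC; apply: f_endo u0 fv fu.
Qed.

Let leaves : {set V} := [set~ ord0].

Let card_leaves : #|leaves| = m.
Proof. by rewrite cardsC1 card_ord. Qed.

Lemma card_IEnd_star_undef :
  #|[set f in IEnd (star m.+1) | f ord0 == None]|
    = \sum_(k < m.+1) 'C(m, k) * m.+1 ^_ k.
Proof.
have -> : [set f in IEnd (star m.+1) | f ord0 == None] = pinj leaves setT.
  apply/setP=> f; rewrite !inE -andbA; apply/and3P/and3P => [[-> _ f0]|].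
    split=> //; last by do 2!apply/forallP=> ?; rewrite inE implybT.
    by apply/subsetP=> u; rewrite !inE; apply: contraNneq => ->.
  case=> f_inj /subsetP f_dom _; have f0 : f ord0 == None.
    by apply/negPn/negP=> f0; have := f_dom ord0; rewrite !inE f0 => /(_ isT).
  by split=> //; apply/pmap_endo_starP=> c u w _; rewrite (eqP f0).
by rewrite card_pinj card_leaves cardsT card_ord.
Qed.

(** Injectivity keeps leaves away from the centre, which is already an image; conversely, sending
    leaves to leaves while fixing the centre preserves every edge. *)
Lemma card_IEnd_star_fix :
  #|[set f in IEnd (star m.+1) | f ord0 == Some ord0]|
    = \sum_(k < m.+1) 'C(m, k) * m ^_ k.
Proof.
pose ext f : {ffun V -> option V} :=
  [ffun x => if x == ord0 then Some ord0 else f x].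
have -> : [set f in IEnd (star m.+1) | f ord0 == Some ord0]
           = ext @: pinj leaves leaves.
  apply/setP=> f; rewrite !inE -andbA; apply/and3P/imsetP.
    case=> /pmap_injP f_inj _ /eqP f0.
    pose g : {ffun V -> option V} := [ffun x => if x == ord0 then None else f x].
    have gS u w : g u = Some w -> u != ord0 /\ f u = Some w.
      by rewrite ffunE; case: eqP.
    exists g; last by apply/ffunP=> u; rewrite !ffunE; case: eqP => // ->.
    apply/pinjP; split.
    - by apply/pmap_injP=> u v w /gS[_ fu] /gS[_ fv]; apply: f_inj fu fv.
    - by move=> u; rewrite !inE negbK ffunE => ->.
    - move=> u w /gS[u0 fu]; rewrite !inE; apply: contraNneq u0 => w0.
      by apply/eqP; apply: f_inj fu _; rewrite w0.
  case=> g /pinjP[/pmap_injP g_inj _ gB] ->.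
  have g0 u : g u <> Some ord0 by move=> /gB; rewrite !inE.
  split; last by rewrite ffunE.
    apply/pmap_injP=> u v w; rewrite !ffunE.
    case: (eqVneq u ord0) => [->|_]; case: (eqVneq v ord0) => [->|_] //.
    - by move=> [<-] /g0.
    - by move=> + [wE]; rewrite -wE => /g0.
    - exact: g_inj.
  apply/pmap_endo_starP=> c u w u0; rewrite !ffunE eqxx (negPf u0) => -[<-].
  by move=> /gB; rewrite !inE => /negPf ->.
rewrite card_in_imset ?card_pinj ?card_leaves //.
(* [ext] overwrites only the value at [ord0], where both maps are [None], so no information is
   lost. *)
move=> f g /pinjP[_ fA _] /pinjP[_ gA _] fg; apply/ffunP=> u.
case: (eqVneq u ord0) => [->|u0]; first by rewrite fA ?gA // !inE eqxx.
by have := congr1 (fun h : {ffun _} => h u) fg; rewrite !ffunE (negPf u0).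
Qed.

Lemma card_IEnd_star_move :
  #|[set f in IEnd (star m.+1) | f ord0 \notin [:: None; Some ord0]]|
    = m * m.+1.
Proof.
(* [l = ord0] encodes that no leaf is in the domain. *)
pose ext (p : V * V) : {ffun V -> option V} :=
  [ffun x => if x == ord0 then Some p.1 else
             if x == p.2 then Some ord0 else None].
have -> : [set f in IEnd (star m.+1) | f ord0 \notin [:: None; Some ord0]]
           = ext @: setX leaves setT.
  apply/setP=> f; rewrite !inE negb_or -andbA; apply/and4P/imsetP.
    case=> /pmap_injP f_inj /pmap_endo_starP f_endo.
    case f0: (f ord0) => [j|] // _ j0.
    have {}j0 : j != ord0 by apply: contraNneq j0 => ->.
    (* The edge from the centre to [u] must go to an edge at the leaf [j], whose other end can only
       be [ord0]. *)
    have fS u w : u != ord0 -> f u = Some w -> w = ord0.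
      by move=> u0 fu; have := f_endo j u w u0 f0 fu; rewrite (negPf j0) => /eqP.
    case: (pickP (fun l => f l == Some ord0)) => [l /eqP fl | no_l].
      exists (j, l); first by rewrite !inE j0.
      apply/ffunP=> u; rewrite ffunE /=.
      case: (eqVneq u ord0) => [-> // | u0]; case: (eqVneq u l) => [-> //|ul].
      case fu: (f u) => [w|] //; case/eqP: ul.
      by apply: (f_inj _ _ _ fu); rewrite (fS _ _ u0 fu).
    exists (j, ord0); first by rewrite !inE j0.
    apply/ffunP=> u; rewrite ffunE /=.
    case: (eqVneq u ord0) => [-> // | u0].
    case fu: (f u) => [w|] //; have := no_l u.
    by rewrite fu (fS _ _ u0 fu) eqxx.
  case=> -[j l]; rewrite !inE andbT /= => j0 ->.
  split; last first.
  - by rewrite ffunE /=; apply: contraNneq j0 => -[->].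
  - by rewrite ffunE.
  - apply/pmap_endo_starP=> c u w u0; rewrite !ffunE /= (negPf u0) => -[<-].
    by case: eqP => // _ [<-]; rewrite (negPf j0).
  apply/pmap_injP=> u v w; rewrite !ffunE /=.
  case: (eqVneq u ord0) => [->|_]; case: (eqVneq v ord0) => [->|_] //.
  - by move=> [<-]; case: eqP => // _ [jE]; rewrite jE eqxx in j0.
  - by case: eqP => // _ [<-] [jE]; rewrite jE eqxx in j0.
  - by case: eqP => // -> _; case: eqP => // ->.
rewrite card_in_imset; first by rewrite cardsX card_leaves cardsT card_ord.
(* The value at [ord0] recovers [j]; comparing values at [l] and [l'] recovers [l]. If [l = ord0],
   the second test in [ext] never fires, so no leaf is in the domain. *)
move=> [j l] [j' l'] _ _ /ffunP jl.
have := jl ord0; rewrite !ffunE /= => -[<-]; congr (_, _).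
have := jl l; have := jl l'; rewrite !ffunE !eqxx /=.
case: (eqVneq l ord0) => [->|l0]; case: (eqVneq l' ord0) => [->|l0'] //.
  by case: eqP.
by move=> _; case: eqP.
Qed.

Lemma card_IEnd_star :
  #|IEnd (star m.+1)|
    = \sum_(k < m.+1) 'C(m, k) * (m.+1 ^_ k + m ^_ k) + m * m.+1.
Proof.
(* Two successive splittings separate the three cases for [f ord0]: undefined, the centre, a
   leaf. *)
rewrite -(cardsID [set f : {ffun V -> option V} | f ord0 == None]).
rewrite -(cardsID [set f : {ffun V -> option V} | f ord0 == Some ord0]
                  (_ :\: _)).
under eq_bigr do rewrite mulnDr.
rewrite big_split /= -addnA -card_IEnd_star_undef -card_IEnd_star_fix.
rewrite -card_IEnd_star_move.
congr (_ + (_ + _)); apply: eq_card => f; rewrite !inE.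
- by [].
- by case: (f ord0) => [w|] //=; rewrite !andbF.
- by case: (f ord0) => [w|] //=; rewrite ?andbT ?andbF // andbC.
Qed.

End Star.

Theorem corollary1p12 (n : nat) (hn : (1 <= n)%N) :
  #|IEnd (star n)|%:Z =
    3 + 3 * n%:Z ^+ 2 - 4 * n%:Z
    + (\sum_(2 <= k < n) ('C(n, k) + 'C(n - 1, k)) * 'C(n - 1, k) * k`!)%N%:Z.
Proof.
case: n hn => // m _; rewrite card_IEnd_star subn1 /=.
rewrite -(big_mkord xpredT (fun k => 'C(m, k) * (m.+1 ^_ k + m ^_ k))%N).
(* A binomial coefficient times [k!] is a falling factorial. *)
have -> : (\sum_(2 <= k < m.+1) ('C(m.+1, k) + 'C(m, k)) * 'C(m, k) * k`!
         = \sum_(2 <= k < m.+1) 'C(m, k) * (m.+1 ^_ k + m ^_ k))%N.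
  by apply: eq_bigr => k _; rewrite -!bin_ffact; lia.
(* For [n = 1] there is no term [k = 1] to split off, and both sides equal 2. *)
case: m => [|m]; first by rewrite big_nat1 big_geq.
(* The terms [k = 0] and [k = 1] are 2 and [(n - 1)(2n - 1)]; with the [(n - 1)n] maps moving the
   centre they give [3 + 3n^2 - 4n]. *)
rewrite big_ltn // big_ltn // !bin0 bin1 !ffactn0 !ffactn1.
lia.
Qed.
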